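(* There exists a function $q\in L_{1,loc}(\mathbb{R}_+)$, $\mathbb{R}_+=[0,+\infty)$, taking purely imaginary values $q(x)\in i\mathbb{R}$ for $x\in\mathbb{R}_+$, with $|q(x)|\to+\infty$ as $x\to+\infty$, such that the following operator $L_0$ has no extension with compact resolvent: $L_0$ is the operator in $L_2(\mathbb{R}_+)$ acting by $L_0y=-y''+qy$ on the domain $$\mathscr{D}_0=\{y\in L_2(\mathbb{R}_+):\ y,y'\in AC_{loc}(\mathbb{R}_+),\ -y''+qy\in L_2(\mathbb{R}_+),\ y(0)=y'(0)=0,\ \exists x_0>0\ \forall x\ge x_0\ y(x)=0\}.$$
   Context: $AC_{loc}(\mathbb{R}_+)$ denotes functions absolutely continuous on every compact subinterval of $[0,+\infty)$. An extension of $L_0$ is an operator $L\supset L_0$ in $L_2(\mathbb{R}_+)$; it has compact resolvent if its resolvent set is nonempty and its resolvent is a compact operator. *)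

(* Defs.v *)
From HB Require Import structures.
From mathcomp Require Import all_boot all_order all_algebra.
From mathcomp Require Import all_classical all_reals all_analysis.
Set Implicit Arguments. Unset Strict Implicit. Unset Printing Implicit Defensive.
Import Order.TTheory GRing.Theory Num.Theory.
Import numFieldNormedType.Exports.
Local Open Scope classical_set_scope.
Local Open Scope ring_scope.

Section Defs.
Variable R : realType.
Local Notation mu := (@lebesgue_measure R).

Definition Rp : set R := `[0, +oo[%classic.

(* complex numbers are represented as pairs (real part, imaginary part);
   a complex-valued function on R_+ is a function R -> R * R (values off R_+
   are irrelevant). *)
Definition cfun := R -> (R * R)%type.

Definition czero : cfun := fun _ => (0, 0).
Definition cadd (f g : cfun) : cfun := fun x => ((f x).1 + (g x).1, (f x).2 + (g x).2).
Definition csub (f g : cfun) : cfun := fun x => ((f x).1 - (g x).1, (f x).2 - (g x).2).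
Definition cscale (l : R * R) (f : cfun) : cfun :=
  fun x => (l.1 * (f x).1 - l.2 * (f x).2, l.1 * (f x).2 + l.2 * (f x).1).

Definition sqnorm (f : cfun) : \bar R :=
  (\int[mu]_(x in Rp) (((f x).1 ^+ 2 + (f x).2 ^+ 2)%:E))%E.

Definition L2 (f : cfun) : Prop :=
  [/\ measurable_fun Rp (fun x => (f x).1), measurable_fun Rp (fun x => (f x).2)
    & (sqnorm f < +oo)%E].

Definition aeeq (f g : cfun) : Prop := {ae mu, forall x, Rp x -> f x = g x}.

(* A (linear, possibly unbounded) operator in L_2(R_+), given by its graph
   G (a set of pairs (y, Ly) of representatives), saturated w.r.t. a.e.
   equality, single-valued on equivalence classes and a complex subspace. *)
Definition is_operator (G : set (cfun * cfun)) : Prop :=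
  [/\ (forall p, G p -> L2 p.1 /\ L2 p.2),
      (forall p p', G p -> L2 p'.1 -> L2 p'.2 -> aeeq p.1 p'.1 -> aeeq p.2 p'.2 -> G p'),
      (forall p p', G p -> G p' -> aeeq p.1 p'.1 -> aeeq p.2 p'.2),
      G (czero, czero)
    & (forall p p' (l : R * R), G p -> G p' ->
         G (cadd p.1 (cscale l p'.1), cadd p.2 (cscale l p'.2)))].

(* L has compact resolvent: some l is in the resolvent set (L - l is a
   bijection of its domain onto L_2 with bounded inverse) and the resolvent
   (L - l)^{-1} is compact (maps bounded sequences to sequences having an
   L_2-convergent subsequence). *)
Definition has_compact_resolvent (G : set (cfun * cfun)) : Prop :=
  exists l : R * R,
  [/\ (forall g, L2 g -> exists f, G (f, cadd g (cscale l f))),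
      (forall f, G (f, cscale l f) -> aeeq f czero),
      (exists C : R, forall f g, L2 g -> G (f, cadd g (cscale l f)) ->
          (sqnorm f <= C%:E * sqnorm g)%E)
    & (forall (fs gs : nat -> cfun) (M : R),
         (forall n, L2 (gs n)) ->
         (forall n, G (fs n, cadd (gs n) (cscale l (fs n)))) ->
         (forall n, (sqnorm (gs n) <= M%:E)%E) ->
         exists phi : nat -> nat, {homo phi : m n / (m < n)%N} /\
         exists f, L2 f /\
           (fun n => sqnorm (csub (fs (phi n)) f)) @ \oo --> 0%E)].

Definition abs_cont (a b : R) (f : R -> R) : Prop :=
  forall e : R, 0 < e -> exists2 d : R, 0 < d &
    forall (n : nat) (s t : 'I_n -> R),
      (forall i, a <= s i /\ s i <= t i /\ t i <= b) ->
      (forall i j, i != j -> t i <= s j \/ t j <= s i) ->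
      \sum_(i < n) (t i - s i) < d ->
      \sum_(i < n) `|f (t i) - f (s i)| < e.

Definition ACloc (f : R -> R) : Prop := forall b : R, 0 < b -> abs_cont 0 b f.

Definition cACloc (f : cfun) : Prop := ACloc (fun x => (f x).1) /\ ACloc (fun x => (f x).2).

Definition L1loc (f : R -> R) : Prop :=
  forall b : R, 0 < b -> mu.-integrable `[0, b] (EFin \o f).

(* -y'' + q y where q = i * qi (qi real-valued), y' = y1, and y'' is the
   pointwise derivative of y1 (which exists a.e. since y1 is AC_loc) *)
Definition Lexpr (qi : R -> R) (y y1 : cfun) : cfun :=
  fun x => (- derive1 (fun t => (y1 t).1) x - qi x * (y x).2,
            - derive1 (fun t => (y1 t).2) x + qi x * (y x).1).

Definition L0graph (qi : R -> R) : set (cfun * cfun) :=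
  fun p => exists y1 : cfun,
    L2 p.1 /\ cACloc p.1 /\ cACloc y1 /\
    (* y1 is the derivative y' of y on (0,+oo); y1(0) = y'(0) by continuity *)
    (forall x : R, 0 < x -> is_derive x (1 : R) (fun t => (p.1 t).1) (y1 x).1 /\
                        is_derive x (1 : R) (fun t => (p.1 t).2) (y1 x).2) /\
    L2 (Lexpr qi p.1 y1) /\
    p.1 0 = (0, 0) /\ y1 0 = (0, 0) /\
    (exists x0 : R, 0 < x0 /\ forall x, x0 <= x -> p.1 x = (0, 0)) /\
    p.2 = Lexpr qi p.1 y1.

End Defs.

(* Main.v *)
(* A singular sequence rules out compact resolvents: if y_n in D_0 is bounded,
   has bounded images L_0 y_n, and its members have disjoint supports and norms
   bounded below, then (L - l)^-1 maps the bounded sequence (L_0 - l) y_n to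
   (y_n), which has no convergent subsequence.
   Such a sequence exists because q oscillates so fast that its large values
   cancel.  With P(x) = S(x^2/2), S(theta) = 2 c - c |c| / 2 and c = cos theta,
   one has P'' = x^2 sigma + O(1), where sigma jumps at the zeros of c and
   1 <= |sigma| <= 3.  For q = i x sigma and a bump v supported in [n, n+1],
   the function y = (x + i P) v satisfies
   -y'' + q y = - (x v)'' - x sigma P v + i (x^2 sigma v - (P v)''),
   in which the terms of order x^2 cancel, leaving O(n) against |y| ~ n. *)
Require Import Defs.
From HB Require Import structures.
From mathcomp Require Import all_boot all_order all_algebra.
From mathcomp Require Import all_classical all_reals all_analysis.
From mathcomp Require Import measurable_realfun ring lra.
Set Implicit Arguments. Unset Strict Implicit. Unset Printing Implicit Defensive.
Import Order.TTheory GRing.Theory Num.Theory.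
Import numFieldNormedType.Exports.
Local Open Scope classical_set_scope.
Local Open Scope ring_scope.

(** * Differentiation through absolute values *)

(** These rules are restated with explicit function bodies, so that derivatives of compound formulas
    can be built as terms and matched to a closed form with [is_derive_eq]. *)
Lemma is_derive_add (R : realType) (f g : R -> R) (x a b : R) :
  is_derive x 1 f a -> is_derive x 1 g b ->
  is_derive x 1 (fun t => f t + g t) (a + b).
Proof. exact: is_deriveD. Qed.

Lemma is_derive_opp (R : realType) (f : R -> R) (x a : R) :
  is_derive x 1 f a -> is_derive x 1 (fun t => - f t) (- a).
Proof. exact: is_deriveN. Qed.

Lemma is_derive_mul (R : realType) (f g : R -> R) (x a b : R) :
  is_derive x 1 f a -> is_derive x 1 g b ->
  is_derive x 1 (fun t => f t * g t) (f x * b + g x * a).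
Proof. exact: is_deriveM. Qed.

Lemma is_derive_const (R : realType) (k x : R) :
  is_derive x 1 (fun=> k) (0 : R).
Proof. exact: is_derive_cst. Qed.

Lemma is_derive_comp (R : realType) (f g : R -> R) (x a b : R) :
  is_derive (g x) 1 f a -> is_derive x 1 g b ->
  is_derive x 1 (fun t => f (g t)) (a * b).
Proof. exact: is_derive1_comp. Qed.

Lemma is_derive_norm (R : realType) (x : R) : x != 0 ->
  is_derive x 1 (fun t => `|t|) (Num.sg x).
Proof.
case: (ltgtP x 0) => // x0 _.
- rewrite ltr0_sg//; apply: near_eq_is_derive (is_derive_opp (is_derive_id x 1)).
  by near=> t; rewrite ltr0_norm//; near: t; exact: lt_nbhsl.
- rewrite gtr0_sg//; apply: near_eq_is_derive (is_derive_id x 1).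
  by near=> t; rewrite gtr0_norm//; near: t; exact: lt_nbhsr.
Unshelve. all: by end_near. Qed.

(** This $C^1$ function is the source of all the limited smoothness below: it enters both the bump
    and the oscillating factor. *)
Lemma is_derive_mul_norm (R : realType) (x : R) :
  is_derive x 1 (fun t => t * `|t|) (2 * `|x|).
Proof.
have [->|x0] := eqVneq x 0.
  (* At 0 the difference quotient of $t|t|$ is $|t|$, which is continuous with value 0. *)
  apply/is_derive1_caratheodory; exists (fun t => `|t|); split.
  - by move=> z; rewrite mul0r !subr0 mulrC.
  - exact: norm_continuous.
  - by rewrite normr0 mulr0.
apply: is_derive_eq (is_derive_mul (is_derive_id x 1) (is_derive_norm x0)) _.
by rewrite mulr1 mulrC -normrEsg mulrC; ring.
Qed.

(** * A truncated cube of class $C^2$ *)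

Section cube.
Variable R : realType.
Implicit Type t : R.

(* [pcube t] is max(t, 0)^3, which is of class C^2. *)
Definition pcube t : R := (t * t * t + t * (t * `|t|)) / 2.
Definition pcube1 t : R := 3 * (t * t + t * `|t|) / 2.
Definition pcube2 t : R := 3 * (t + `|t|).

Lemma is_derive_pcube t : is_derive t 1 pcube (pcube1 t).
Proof.
have I := is_derive_id t (1 : R).
apply: is_derive_eq (is_derive_mul (is_derive_add
  (is_derive_mul (is_derive_mul I I) I)
  (is_derive_mul I (is_derive_mul_norm t))) (is_derive_const 2^-1 t)) _.
by rewrite /pcube1; field.
Qed.

Lemma is_derive_pcube1 t : is_derive t 1 pcube1 (pcube2 t).
Proof.
have I := is_derive_id t (1 : R).
apply: is_derive_eq (is_derive_mul (is_derive_mul (is_derive_const 3 t)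
  (is_derive_add (is_derive_mul I I) (is_derive_mul_norm t)))
  (is_derive_const 2^-1 t)) _.
by rewrite /pcube2; field.
Qed.

Lemma pcube_le0 t : t <= 0 -> [/\ pcube t = 0, pcube1 t = 0 & pcube2 t = 0].
Proof.
by move=> t0; rewrite /pcube /pcube1 /pcube2 ler0_norm//; split; field.
Qed.

Lemma pcube_ge0 t : 0 <= t ->
  [/\ pcube t = t ^+ 3, pcube1 t = 3 * t ^+ 2 & pcube2 t = 6 * t].
Proof.
by move=> t0; rewrite /pcube /pcube1 /pcube2 ger0_norm//; split; field.
Qed.

End cube.

(** * The oscillating factor and its second derivative *)

Section wave.
Variable R : realType.
Implicit Type x : R.

Definition wcos x : R := cos (x * x / 2).
Definition wsin x : R := sin (x * x / 2).
(** A periodic $C^2$ function has a second derivative of mean zero, which must vanish somewhere. The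
    term $c|c|/2$ lets the second derivative in the phase jump across 0 instead, at the zeros of
    $c$. *)
Definition wave x : R := 2 * wcos x - wcos x * `|wcos x| / 2.
Definition wave1 x : R := - (x * (wsin x * (2 - `|wcos x|))).
(* The sign factor is nonzero even where [wcos x = 0], so that
   [1 <= `|amp x|] everywhere. *)
Definition amp x : R :=
  - ((if 0 <= wcos x then 1 else -1) * (1 + 2 * `|wcos x| - 2 * wcos x ^+ 2)).

Lemma is_derive_phase x : is_derive x 1 (fun t : R => t * t / 2) x.
Proof.
have I := is_derive_id x (1 : R).
apply: is_derive_eq (is_derive_mul (is_derive_mul I I) (is_derive_const 2^-1 x)) _.
by rewrite /=; field.
Qed.

Lemma is_derive_wcos x : is_derive x 1 wcos (- (x * wsin x)).
Proof.
apply: is_derive_eq (is_derive_comp (is_derive_cos _) (is_derive_phase x)) _.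
by rewrite /wsin; ring.
Qed.

Lemma is_derive_wsin x : is_derive x 1 wsin (x * wcos x).
Proof.
apply: is_derive_eq (is_derive_comp (is_derive_sin _) (is_derive_phase x)) _.
by rewrite /wcos; ring.
Qed.

Lemma is_derive_wave x : is_derive x 1 wave (wave1 x).
Proof.
have C := is_derive_wcos x.
apply: is_derive_eq (is_derive_add (is_derive_mul (is_derive_const 2 x) C)
  (is_derive_opp (is_derive_mul (is_derive_comp (is_derive_mul_norm _) C)
  (is_derive_const 2^-1 x)))) _.
by rewrite /wave1; field.
Qed.

Lemma wcos2Dwsin2 x : wcos x ^+ 2 + wsin x ^+ 2 = 1.
Proof. exact: cos2Dsin2. Qed.

(** Away from the zeros of $c$ = [wcos x] the chain rule applies to $|c|$. With $s^2 = 1 - c^2$, the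
    coefficient of $-x^2$ is $\mathrm{sg}(c)(1 - c^2) + (2 - |c|)c = \mathrm{sg}(c)(1 + 2|c| -
    2c^2)$. *)
Lemma is_derive_wave1 x : wcos x != 0 ->
  is_derive x 1 wave1 (- (wsin x * (2 - `|wcos x|)) + x ^+ 2 * amp x).
Proof.
move=> c0.
apply: is_derive_eq (is_derive_opp (is_derive_mul (is_derive_id x 1)
  (is_derive_mul (is_derive_wsin x) (is_derive_add (is_derive_const 2 x)
  (is_derive_opp (is_derive_comp (is_derive_norm c0) (is_derive_wcos x))))))) _.
have sE : wsin x ^+ 2 = 1 - wcos x ^+ 2 by rewrite -(wcos2Dwsin2 x); ring.
have -> : - (x * (wsin x * (0 - Num.sg (wcos x) * - (x * wsin x)) +
    (2 - `|wcos x|) * (x * wcos x)) + wsin x * (2 - `|wcos x|) * 1) =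
  - (wsin x * (2 - `|wcos x|)) -
    x ^+ 2 * (Num.sg (wcos x) * wsin x ^+ 2 + (2 - `|wcos x|) * wcos x) by ring.
rewrite sE /amp; case: (ltgtP (wcos x) 0) c0 => // c0 _.
  by rewrite ltr0_sg// ltr0_norm//; ring.
by rewrite gtr0_sg// gtr0_norm//; ring.
Qed.

Lemma norm_wcos_le1 x : `|wcos x| <= 1. Proof. exact: cos_max. Qed.
Lemma norm_wsin_le1 x : `|wsin x| <= 1. Proof. exact: sin_max. Qed.

Lemma norm_amp x : `|amp x| = 1 + 2 * `|wcos x| - 2 * wcos x ^+ 2.
Proof.
have := norm_wcos_le1 x; have := normr_ge0 (wcos x).
rewrite /amp normrN normrM -(real_normK (num_real (wcos x))) => c0 c1.
have -> : `|if 0 <= wcos x then 1 else -1| = 1 :> R.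
  by case: ifP => _; rewrite ?normrN normr1.
by rewrite mul1r ger0_norm//; nra.
Qed.

Lemma countable_wcos_eq0 : countable [set x | 0 <= x /\ wcos x = 0].
Proof.
pose zero (n : nat) : R := Num.sqrt (2 * (pi / 2 + n%:R * pi)).
apply: (@sub_countable _ _ _ (range zero)); last first.
  by apply: card_le_trans (card_image_le _ _) _; exact: countableP.
apply: subset_card_le => x [x0 cx].
have pi0 : 0 < pi :> R := pi_gt0 R.
have t0 : 0 <= x * x / 2 / pi by rewrite !divr_ge0// ?mulr_ge0// ltW.
have /andP[n1 n2] := truncn_itv t0.
set n := Num.truncn _ in n1 n2.
exists n => //=; rewrite /zero.
(* As [n] is the integer part of the phase divided by $\pi$, the remainder lies in $[0, \pi]$, where
   cosine is injective; its cosine is 0 because shifting by $n\pi$ only multiplies by $(-1)^n$. *)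
have : x * x / 2 - n%:R * pi = pi / 2.
  apply: cos_inj.
  - rewrite in_itv/=; move: n1 n2; rewrite ler_pdivlMr// ltr_pdivrMr// -natr1 => ? ?.
    by apply/andP; split; lra.
  - by rewrite in_itv/=; apply/andP; split; lra.
  - rewrite cos_pihalf.
    have := alternatingn (@cosDpi R) n (x * x / 2 - n%:R * pi).
    rewrite mulr_natl subrK -/(wcos x) cx => /esym/eqP.
    by rewrite mulf_eq0 signr_eq0 => /eqP.
move=> E; have -> : 2 * (pi / 2 + n%:R * pi) = x ^+ 2 by rewrite -E; field.
by rewrite sqrtr_sqr ger0_norm.
Qed.

End wave.

(** * Local Lipschitz continuity *)

Section lipschitz.
Variable R : realType.
Implicit Types (f g : R -> R) (b K : R).

(** A property that implies [ACloc] and passes through sums, products, absolute values, sine and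
    cosine. It covers [wave1], which contains $|\cos|$ and so escapes a plain $C^1$ argument. *)
Definition locally_lipschitz f := forall b, exists2 K, 0 <= K &
  forall x y, 0 <= x <= b -> 0 <= y <= b -> `|f x - f y| <= K * `|x - y|.

Lemma locally_lipschitz_cst (k : R) : locally_lipschitz (fun=> k).
Proof. by move=> b; exists 0 => // x y _ _; rewrite subrr normr0 mul0r. Qed.

Lemma locally_lipschitz_id : locally_lipschitz id.
Proof. by move=> b; exists 1 => // x y _ _; rewrite mul1r. Qed.

Lemma locally_lipschitzD f g : locally_lipschitz f -> locally_lipschitz g ->
  locally_lipschitz (fun x => f x + g x).
Proof.
move=> lf lg b; have [K K0 fK] := lf b; have [L L0 gL] := lg b.
exists (K + L); first exact: addr_ge0.
move=> x y xb yb.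
have -> : f x + g x - (f y + g y) = (f x - f y) + (g x - g y) by ring.
by rewrite (le_trans (ler_normD _ _))// mulrDl lerD ?fK ?gL.
Qed.

Lemma locally_lipschitzM f g : locally_lipschitz f -> locally_lipschitz g ->
  locally_lipschitz (fun x => f x * g x).
Proof.
move=> lf lg b; have [K K0 fK] := lf b; have [L L0 gL] := lg b.
(* The product estimate needs both factors bounded on $[0, b]$; comparison with the value at 0 gives
   this. *)
have bounded h M : 0 <= M ->
    (forall x y, 0 <= x <= b -> 0 <= y <= b -> `|h x - h y| <= M * `|x - y|) ->
    forall x, 0 <= x <= b -> `|h x| <= `|h 0| + M * b.
  move=> M0 hM x /andP[x0 xb]; rewrite -lerBlDl.
  apply: le_trans (lerB_dist _ _) _; apply: le_trans (hM x 0 _ _) _.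
  - by rewrite x0.
  - by rewrite lexx (le_trans x0).
  - by rewrite subr0 ger0_norm// ler_wpM2l.
(* The absolute value of [b] keeps the constant nonnegative when $b < 0$ and $[0, b]$ is empty. *)
exists ((`|f 0| + K * `|b|) * L + (`|g 0| + L * `|b|) * K).
  by rewrite addr_ge0// mulr_ge0// addr_ge0// mulr_ge0.
move=> x y xb yb.
have b0 : 0 <= b by case/andP: xb => /le_trans h /h.
have -> : f x * g x - f y * g y = f x * (g x - g y) + g y * (f x - f y) by ring.
rewrite (le_trans (ler_normD _ _))// !normrM mulrDl -!mulrA (ger0_norm b0).
apply: lerD.
  by apply: ler_pM => //; [exact: bounded|exact: gL].
by apply: ler_pM => //; [exact: bounded|exact: fK].
Qed.

Lemma locally_lipschitzN f : locally_lipschitz f ->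
  locally_lipschitz (fun x => - f x).
Proof.
move=> lf b; have [K K0 fK] := lf b; exists K => // x y xb yb.
by rewrite -opprD normrN fK.
Qed.

Lemma locally_lipschitz_comp1 (h : R -> R) f :
  (forall x y, `|h x - h y| <= `|x - y|) ->
  locally_lipschitz f -> locally_lipschitz (fun x => h (f x)).
Proof.
move=> h1 lf b; have [K K0 fK] := lf b; exists K => // x y xb yb.
exact: le_trans (h1 _ _) (fK _ _ xb yb).
Qed.

Lemma is_derive_continuous f (f' : R -> R) :
  (forall x : R, is_derive x 1 f (f' x)) -> continuous f.
Proof.
move=> df x; apply: differentiable_continuous; apply/derivable1_diffP.
by case: (df x).
Qed.

Lemma contracting_is_derive f (f' : R -> R) :
  (forall x : R, is_derive x 1 f (f' x)) -> (forall x, `|f' x| <= 1) ->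
  forall x y, `|f x - f y| <= `|x - y|.
Proof.
move=> df f1 x y; wlog xy : x y / y <= x.
  by move=> H; case: (leP y x) => [/H//|/ltW/H]; rewrite distrC (distrC y).
have [z _ ->] := MVT_segment xy (fun z _ => df z)
  (continuous_subspaceT (is_derive_continuous df)).
by rewrite normrM ler_piMl.
Qed.

Lemma locally_lipschitz_norm f : locally_lipschitz f ->
  locally_lipschitz (fun x => `|f x|).
Proof. by apply: (locally_lipschitz_comp1 (h := Num.norm)); exact: ler_dist_dist. Qed.

Lemma locally_lipschitz_cos f : locally_lipschitz f ->
  locally_lipschitz (fun x => cos (f x)).
Proof.
apply: (locally_lipschitz_comp1 (h := cos)).
apply: (@contracting_is_derive cos (fun x => - sin x)) => x.
by rewrite normrN sin_max.
Qed.

Lemma locally_lipschitz_sin f : locally_lipschitz f ->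
  locally_lipschitz (fun x => sin (f x)).
Proof.
apply: (locally_lipschitz_comp1 (h := sin)).
apply: (@contracting_is_derive sin cos) => x; exact: cos_max.
Qed.

Lemma locally_lipschitz_ACloc f : locally_lipschitz f -> ACloc f.
Proof.
move=> lf b b0 e e0; have [K K0 fK] := lf b.
(* The denominator is $K + 1$ since $K$ may be 0. *)
exists (e / (K + 1)); first by rewrite divr_gt0// ltr_wpDl.
move=> n s t st _ sd.
apply: (@le_lt_trans _ _ (\sum_(i < n) K * (t i - s i))).
  apply: ler_sum => i _; have [s0 [sti tb]] := st i.
  rewrite -[in leRHS](@ger0_norm _ (t i - s i)) ?subr_ge0// fK//.
    by rewrite tb (le_trans s0 sti).
  by rewrite s0 (le_trans sti tb).
rewrite -mulr_sumr; apply: le_lt_trans (ler_wpM2l K0 (ltW sd)) _.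
by rewrite mulrCA gtr_pMr// ltr_pdivrMr ?ltr_wpDl// mul1r ltrDl.
Qed.

End lipschitz.

(** * Measurability and norms *)

Section measurability.
Variable R : realType.

Lemma is_derive_measurable (f f' : R -> R) (D : set R) :
  (forall x : R, is_derive x 1 f (f' x)) -> measurable_fun D f.
Proof.
move=> df; apply: (measurable_funS measurableT) => //.
exact: continuous_measurable_fun (is_derive_continuous df).
Qed.

(** The preimages under [f] and [g] differ only inside a countable set, all of whose subsets are
    Borel. This serves for [Lexpr], whose closed form is known only off the zeros of [wcos]. *)
Lemma eq_measurable_fun_countable (D Z : set R) (f g : R -> R) :
  countable Z -> (forall x, D x -> ~ Z x -> f x = g x) ->
  measurable_fun D g -> measurable_fun D f.
Proof.
move=> cZ fg mg mD B mB.
have -> : D `&` f @^-1` B = ((D `&` g @^-1` B) `\` Z) `|` (Z `&` (D `&` f @^-1` B)).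
  apply/seteqP; split => x /=.
    move=> [Dx Bx]; have [Zx|Zx] := pselect (Z x); first by right.
    by left; rewrite -fg.
  by move=> [[[Dx Bx] Zx]|[]//]; split => //; rewrite fg.
have meas (A : set R) : countable A -> measurable A.
  by move=> cA; apply: countable_measurable cA => t; exact: measurable_set1.
apply: measurableU.
  by apply: measurableD; [exact: mg|exact: meas].
by apply: meas; apply: sub_countable cZ; apply: subset_card_le; exact: subIsetl.
Qed.

Lemma ae_countable (Z : set R) (P : R -> Prop) : countable Z ->
  (forall x, ~ Z x -> P x) -> {ae @lebesgue_measure R, forall x, P x}.
Proof.
move=> cZ ZP; exists Z; split.
- by apply: countable_measurable cZ => t; exact: measurable_set1.
- exact: countable_lebesgue_measure0.
- by move=> x /= Px; apply: contrapT => Zx; apply/Px/ZP.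
Qed.

Lemma measurable_Rp : measurable (@Rp R).
Proof. exact: measurable_itv. Qed.

Lemma measurable_sqnorm (D : set R) (f : cfun R) :
  measurable_fun D (fun x => (f x).1) -> measurable_fun D (fun x => (f x).2) ->
  measurable_fun D (fun x => ((f x).1 ^+ 2 + (f x).2 ^+ 2)%:E).
Proof.
move=> m1 m2; apply/measurable_EFinP.
by apply: measurable_funD; exact: measurable_funX.
Qed.

(** The supporting interval has length 1, so a pointwise bound is itself a norm bound. *)
Lemma sqnorm_le_unit (f : cfun R) (N K : R) : 0 <= N -> 0 <= K ->
  measurable_fun (@Rp R) (fun x => (f x).1) -> measurable_fun (@Rp R) (fun x => (f x).2) ->
  {ae @lebesgue_measure R, forall x, Rp x ->
    (f x).1 ^+ 2 + (f x).2 ^+ 2 <= K * \1_(`[N, N + 1]%classic) x} ->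
  (sqnorm f <= K%:E)%E.
Proof.
move=> N0 K0 m1 m2 fK.
have mI : measurable (`[N, N + 1]%classic : set R) by exact: measurable_itv.
have mind : measurable_fun (@Rp R) (fun x => (\1_(`[N, N + 1]%classic) x : R)%:E).
  by apply/measurable_EFinP; exact: measurable_indic.
apply: (@le_trans _ _ (\int[@lebesgue_measure R]_(x in (@Rp R))
    (K%:E * (\1_(`[N, N + 1]%classic) x)%:E))%E).
  apply: ae_ge0_le_integral => //.
  - exact: measurable_Rp.
  - by move=> x _; rewrite lee_fin addr_ge0// sqr_ge0.
  - exact: measurable_sqnorm.
  - by move=> x _; rewrite mule_ge0// lee_fin.
  - exact: measurable_funeM.
rewrite ge0_integralZl_EFin//; last exact: measurable_Rp.
rewrite integral_indic//; last exact: measurable_Rp.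
rewrite -[leRHS]mule1; apply: lee_wpmul2l; first by rewrite lee_fin.
apply: (@le_trans _ _ (@lebesgue_measure R `[N, N + 1])).
  by apply: le_measure; rewrite ?inE//; apply: measurableI => //; exact: measurable_Rp.
by rewrite lebesgue_measure_itv/= lte_fin ltrDl ltr01 -EFinD lee_fin; lra.
Qed.

End measurability.

(** * The singular sequence *)

Section singular_sequence.
Variables (R : realType) (N : R).
Implicit Type x : R.

Definition tent x : R := (x - N) * (N + 1 - x).
Definition dtent x : R := 2 * N + 1 - 2 * x.
(** A $C^2$ bump supported on $[N, N+1]$, where [tent] is nonnegative. The factor $(N+1)^{-1}$
    offsets the growth of $x$ in [trial], so that its norms stay bounded above and below. *)
Definition cutoff x : R := (N + 1)^-1 * pcube (tent x).
Definition cutoff1 x : R := (N + 1)^-1 * (pcube1 (tent x) * dtent x).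
Definition cutoff2 x : R :=
  (N + 1)^-1 * (pcube2 (tent x) * dtent x ^+ 2 - 2 * pcube1 (tent x)).

Definition trial : cfun R := fun x => (x * cutoff x, wave x * cutoff x).
Definition trial1 : cfun R := fun x =>
  (cutoff x + x * cutoff1 x, wave1 x * cutoff x + wave x * cutoff1 x).
(** The closed form of $-y'' + qy$ after cancellation: no term carries more than one factor $x$. *)
Definition trial_image : cfun R := fun x =>
  (- (2 * cutoff1 x + x * cutoff2 x) - x * amp x * (wave x * cutoff x),
   wsin x * (2 - `|wcos x|) * (cutoff x + 2 * x * cutoff1 x) - wave x * cutoff2 x).

Lemma is_derive_tent x : is_derive x 1 tent (dtent x).
Proof.
have I := is_derive_id x (1 : R).
apply: is_derive_eq (is_derive_mul (is_derive_add I (is_derive_const (- N) x))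
  (is_derive_add (is_derive_const (N + 1) x) (is_derive_opp I))) _.
by rewrite /dtent; ring.
Qed.

Lemma is_derive_cutoff x : is_derive x 1 cutoff (cutoff1 x).
Proof.
apply: is_derive_eq (is_derive_mul (is_derive_const (N + 1)^-1 x)
  (is_derive_comp (is_derive_pcube (tent x)) (is_derive_tent x))) _.
by rewrite /cutoff1; ring.
Qed.

Lemma is_derive_cutoff1 x : is_derive x 1 cutoff1 (cutoff2 x).
Proof.
have dd : is_derive x 1 dtent (- 2).
  apply: is_derive_eq (is_derive_add (is_derive_const (2 * N + 1) x)
    (is_derive_opp (is_derive_mul (is_derive_const 2 x) (is_derive_id x 1)))) _.
  by ring.
apply: is_derive_eq (is_derive_mul (is_derive_const (N + 1)^-1 x)
  (is_derive_mul (is_derive_comp (is_derive_pcube1 (tent x)) (is_derive_tent x)) dd)) _.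
by rewrite /cutoff2; ring.
Qed.

Lemma is_derive_trial_re x : is_derive x 1 (fun t => (trial t).1) (trial1 x).1.
Proof.
apply: is_derive_eq (is_derive_mul (is_derive_id x 1) (is_derive_cutoff x)) _.
by rewrite /=; ring.
Qed.

Lemma is_derive_trial_im x : is_derive x 1 (fun t => (trial t).2) (trial1 x).2.
Proof.
apply: is_derive_eq (is_derive_mul (is_derive_wave x) (is_derive_cutoff x)) _.
by rewrite /=; ring.
Qed.

Lemma is_derive_trial1_re x :
  is_derive x 1 (fun t => (trial1 t).1) (2 * cutoff1 x + x * cutoff2 x).
Proof.
apply: is_derive_eq (is_derive_add (is_derive_cutoff x)
  (is_derive_mul (is_derive_id x 1) (is_derive_cutoff1 x))) _.
by ring.
Qed.

Lemma is_derive_trial1_im x : wcos x != 0 ->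
  is_derive x 1 (fun t => (trial1 t).2)
    ((- (wsin x * (2 - `|wcos x|)) + x ^+ 2 * amp x) * cutoff x
     + 2 * wave1 x * cutoff1 x + wave x * cutoff2 x).
Proof.
move=> c0.
apply: is_derive_eq (is_derive_add
  (is_derive_mul (is_derive_wave1 c0) (is_derive_cutoff x))
  (is_derive_mul (is_derive_wave x) (is_derive_cutoff1 x))) _.
by ring.
Qed.

(** In the imaginary part, $-y''$ contributes $-x^2$ [amp x * cutoff x], and multiplying the real
    part $x$ [cutoff x] by the potential $x$ [amp x] contributes the opposite term. *)
Lemma Lexpr_trial x : wcos x != 0 ->
  Lexpr (fun t => t * amp t) trial trial1 x = trial_image x.
Proof.
move=> c0.
have [_ d1] := is_derive_trial1_re x; have [_ d2] := is_derive_trial1_im c0.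
rewrite /Lexpr !derive1E d1 d2 /trial_image /trial /= /wave1.
by congr (_, _); ring.
Qed.

(** * Absolute continuity of the trial functions and their derivatives *)

Lemma locally_lipschitz_pcube (f : R -> R) : locally_lipschitz f ->
  locally_lipschitz (fun x => pcube (f x)) /\
  locally_lipschitz (fun x => pcube1 (f x)).
Proof.
move=> lf; have ln := locally_lipschitz_norm lf.
have l2 := locally_lipschitzM lf lf.
have lfn := locally_lipschitzM lf ln.
split; apply: locally_lipschitzM (locally_lipschitz_cst _).
  by apply: locally_lipschitzD; exact: locally_lipschitzM.
apply: locally_lipschitzM (locally_lipschitz_cst _) _.
exact: locally_lipschitzD.
Qed.

Lemma locally_lipschitz_tent : locally_lipschitz tent.
Proof.
have I := @locally_lipschitz_id R; have C := @locally_lipschitz_cst R.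
apply: locally_lipschitzM; first exact: locally_lipschitzD.
by apply: locally_lipschitzD => //; exact: locally_lipschitzN.
Qed.

Lemma locally_lipschitz_cutoff : locally_lipschitz cutoff.
Proof.
apply: locally_lipschitzM; first exact: locally_lipschitz_cst.
exact: (locally_lipschitz_pcube locally_lipschitz_tent).1.
Qed.

Lemma locally_lipschitz_cutoff1 : locally_lipschitz cutoff1.
Proof.
have I := @locally_lipschitz_id R; have C := @locally_lipschitz_cst R.
apply: locally_lipschitzM => //; apply: locally_lipschitzM.
  exact: (locally_lipschitz_pcube locally_lipschitz_tent).2.
apply: locally_lipschitzD => //; apply: locally_lipschitzN.
exact: locally_lipschitzM.
Qed.

Lemma locally_lipschitz_wave :
  locally_lipschitz (@wave R) /\ locally_lipschitz (@wave1 R).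
Proof.
have I := @locally_lipschitz_id R; have C := @locally_lipschitz_cst R.
have ph : locally_lipschitz (fun x : R => x * x / 2).
  by apply: locally_lipschitzM => //; exact: locally_lipschitzM.
have lc : locally_lipschitz (@wcos R) := locally_lipschitz_cos ph.
have ls : locally_lipschitz (@wsin R) := locally_lipschitz_sin ph.
have ln := locally_lipschitz_norm lc.
split.
  apply: locally_lipschitzD; first exact: locally_lipschitzM.
  apply: locally_lipschitzN; apply: locally_lipschitzM => //.
  exact: locally_lipschitzM.
apply: locally_lipschitzN; apply: locally_lipschitzM => //.
apply: locally_lipschitzM => //; apply: locally_lipschitzD => //.
exact: locally_lipschitzN.
Qed.

Lemma cACloc_trial : cACloc trial.
Proof.
have I := @locally_lipschitz_id R; have [w _] := locally_lipschitz_wave.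
have b := locally_lipschitz_cutoff.
by split; apply: locally_lipschitz_ACloc; exact: locally_lipschitzM.
Qed.

Lemma cACloc_trial1 : cACloc trial1.
Proof.
have I := @locally_lipschitz_id R; have [w w1] := locally_lipschitz_wave.
have b := locally_lipschitz_cutoff; have b1 := locally_lipschitz_cutoff1.
split; apply: locally_lipschitz_ACloc; apply: locally_lipschitzD => //;
  exact: locally_lipschitzM.
Qed.

(** * Pointwise bounds for the bump, the trial functions and their images *)

Lemma cutoff_out x : x <= N \/ N + 1 <= x ->
  [/\ cutoff x = 0, cutoff1 x = 0 & cutoff2 x = 0].
Proof.
move=> xN; have /pcube_le0[p0 p1 p2] : tent x <= 0.
  rewrite /tent; case: xN => xN; [apply: mulr_le0_ge0|apply: mulr_ge0_le0]; lra.
by rewrite /cutoff /cutoff1 /cutoff2 p0 p1 p2 !mul0r !mulr0 subr0 mulr0.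
Qed.

(** With $t$ = [tent x] in $[0, 1/4]$ and $d$ = [dtent x] in $[-1, 1]$, the three quantities are
    $(N+1)^{-1}$ times $t^3$, $3t^2 d$ and $6td^2 - 6t^2$. *)
Lemma cutoff_in x : 1 <= N -> N <= x <= N + 1 ->
  [/\ `|cutoff x| <= (N + 1)^-1, `|cutoff1 x| <= (N + 1)^-1
    & `|cutoff2 x| <= 4 * (N + 1)^-1].
Proof.
move=> N1 /andP[Nx xN].
have k0 : 0 < (N + 1)^-1 by rewrite invr_gt0; lra.
have t0 : 0 <= tent x by rewrite /tent mulr_ge0// subr_ge0.
have t1 : tent x <= 1 / 4.
  (* Completing the square: [tent x] is $1/4 - (x - N - 1/2)^2$. *)
  by rewrite /tent; have := sqr_ge0 (x - N - 1 / 2); lra.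
have d1 : `|dtent x| <= 1 by rewrite ler_norml /dtent; apply/andP; split; lra.
have [p0 p1 p2] := pcube_ge0 t0.
have t20 : 0 <= tent x ^+ 2 by exact: sqr_ge0.
have t2 : tent x ^+ 2 <= 1 / 16 by nra.
have t30 : 0 <= tent x ^+ 3 by exact: exprn_ge0.
have t3 : tent x ^+ 3 <= 1 by rewrite exprS; nra.
have d20 : 0 <= dtent x ^+ 2 by exact: sqr_ge0.
have d21 : dtent x ^+ 2 <= 1.
  by rewrite -(real_normK (num_real (dtent x))) expr_le1.
rewrite /cutoff /cutoff1 /cutoff2 p0 p1 p2 {p0 p1 p2}.
move: (tent x) (dtent x) t0 t1 d1 t20 t2 t30 t3 d20 d21.
move=> t d t0 t1 d1 t20 t2 t30 t3 d20 d21.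
rewrite !(normrM (N + 1)^-1) (normrM _ d) (gtr0_norm k0); split.
- by apply: ler_piMr; rewrite ?ger0_norm// ltW.
- apply: ler_piMr; first exact: ltW.
  by apply: mulr_ile1 => //; rewrite ger0_norm//; lra.
- have td0 : 0 <= t * d ^+ 2 by exact: mulr_ge0.
  have td1 : t * d ^+ 2 <= 1 / 4 by rewrite -[leRHS]mulr1 ler_pM.
  rewrite mulrC ler_pM2r// ler_norml; apply/andP; split; lra.
Qed.

Lemma norm_wave x : `|wave x| <= 3.
Proof.
have := norm_wcos_le1 x; rewrite /wave => c1.
have h : `|wcos x * `|wcos x| / 2| <= 1.
  have c2 : `|wcos x| * `|wcos x| <= 1 by exact: mulr_ile1.
  by rewrite normrM [`|_ * _|]normrM normr_id (@ger0_norm _ 2^-1) ?invr_ge0//; lra.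
by move: c1 h; rewrite !ler_norml => /andP[? ?] /andP[? ?]; apply/andP; split; lra.
Qed.

Lemma norm_amp_le x : `|amp x| <= 3.
Proof.
rewrite norm_amp; have := norm_wcos_le1 x; have := sqr_ge0 (wcos x); lra.
Qed.

(** The parts are at most 1 and 3 in absolute value, since $x \le N + 1$ and [wave] is bounded by 3;
    hence $10 = 1^2 + 3^2$. *)
Lemma trial_le x : 1 <= N -> (trial x).1 ^+ 2 + (trial x).2 ^+ 2 <=
  10 * \1_(`[N, N + 1]%classic) x.
Proof.
move=> N1; rewrite indicE; case: (boolP (x \in _)) => xN; last first.
  have [|b0 _ _] := @cutoff_out x.
    move: xN; rewrite notin_setE/= in_itv/= => /negP; rewrite negb_and -!ltNge.
    by case/orP => /ltW; [left|right].
  by rewrite /= b0 !mulr0 expr0n/= addr0.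
move: xN; rewrite inE/= in_itv/= => xN; have [b0 _ _] := cutoff_in N1 xN.
have k0 : 0 < (N + 1)^-1 by rewrite invr_gt0; lra.
have h1 : `|(trial x).1| <= 1.
  rewrite normrM ger0_norm; last by lra.
  apply: (@le_trans _ _ ((N + 1) * (N + 1)^-1)); last by rewrite divff//; lra.
  by apply: ler_pM => //; lra.
have h2 : `|(trial x).2| <= 3.
  rewrite normrM -[leRHS]mulr1; apply: ler_pM => //; first exact: norm_wave.
  by apply: (le_trans b0); rewrite invf_le1; lra.
rewrite -(real_normK (num_real (trial x).1)) -(real_normK (num_real (trial x).2)).
have := normr_ge0 (trial x).1; have := normr_ge0 (trial x).2; rewrite mulr1; nra.
Qed.

Lemma trial_image_le x : 1 <= N -> (trial_image x).1 ^+ 2 + (trial_image x).2 ^+ 2 <=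
  700 * \1_(`[N, N + 1]%classic) x.
Proof.
move=> N1; rewrite indicE; case: (boolP (x \in _)) => xN; last first.
  have [|b0 b1 b2] := @cutoff_out x.
    move: xN; rewrite notin_setE/= in_itv/= => /negP; rewrite negb_and -!ltNge.
    by case/orP => /ltW; [left|right].
  by rewrite /= b0 b1 b2 !(mulr0, addr0, oppr0, subr0) expr0n/= addr0.
move: xN; rewrite inE/= in_itv/= => xN; have [b0 b1 b2] := cutoff_in N1 xN.
have k0 : 0 < (N + 1)^-1 by rewrite invr_gt0; lra.
have k1 : (N + 1)^-1 <= 1 by rewrite invf_le1; lra.
(* The normalisation of the bump absorbs the single factor $x$ of each term. *)
have xk u M : 0 <= M -> `|u| <= M * (N + 1)^-1 -> `|x * u| <= M.
  move=> M0 uM; rewrite normrM ger0_norm; last by lra.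
  apply: (@le_trans _ _ ((N + 1) * (M * (N + 1)^-1))).
    by apply: ler_pM => //; lra.
  by rewrite mulrCA divff ?mulr1//; lra.
have s1 : `|wsin x * (2 - `|wcos x|)| <= 3.
  rewrite normrM -[leRHS]mul1r; apply: ler_pM => //; first exact: norm_wsin_le1.
  by rewrite ler_norml; have := norm_wcos_le1 x; have := normr_ge0 (wcos x);
     move=> ? ?; apply/andP; split; lra.
have g1 : `|(trial_image x).1| <= 15.
  have -> : (trial_image x).1 =
      - (2 * cutoff1 x) + - (x * cutoff2 x) + - (amp x * (wave x * (x * cutoff x))).
    by rewrite /=; ring.
  have h : `|amp x * (wave x * (x * cutoff x))| <= 3 * (3 * 1).
    rewrite normrM; apply: ler_pM => //; first exact: norm_amp_le.
    rewrite normrM; apply: ler_pM => //; first exact: norm_wave.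
    by apply: xk; rewrite ?mul1r.
  have h2 : `|x * cutoff2 x| <= 4 by exact: xk.
  have h1 : `|2 * cutoff1 x| <= 2 by rewrite normrM ger0_norm//; lra.
  apply: (le_trans (ler_normD _ _)); rewrite normrN.
  have := ler_normD (- (2 * cutoff1 x)) (- (x * cutoff2 x)); rewrite !normrN; lra.
have g2 : `|(trial_image x).2| <= 21.
  have -> : (trial_image x).2 = wsin x * (2 - `|wcos x|) *
      (cutoff x + 2 * (x * cutoff1 x)) + - (wave x * cutoff2 x) by rewrite /=; ring.
  have h : `|cutoff x + 2 * (x * cutoff1 x)| <= 3.
    have := ler_normD (cutoff x) (2 * (x * cutoff1 x)).
    have : `|x * cutoff1 x| <= 1 by apply: xk; rewrite ?mul1r.
    by rewrite (normrM 2) (@ger0_norm _ 2)//; lra.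
  have h1 : `|wsin x * (2 - `|wcos x|) * (cutoff x + 2 * (x * cutoff1 x))| <= 3 * 3.
    by rewrite normrM; exact: ler_pM.
  have h2 : `|wave x * cutoff2 x| <= 3 * 4.
    by rewrite normrM; apply: ler_pM => //; [exact: norm_wave|lra].
  by apply: (le_trans (ler_normD _ _)); rewrite normrN; lra.
(* The constant 700 covers $15^2 + 21^2 = 666$. *)
rewrite -(real_normK (num_real (trial_image x).1)).
rewrite -(real_normK (num_real (trial_image x).2)).
have := normr_ge0 (trial_image x).1; have := normr_ge0 (trial_image x).2.
by rewrite mulr1; nra.
Qed.

(** On the middle half of the support, [tent] is at least $\frac14\cdot\frac34 = \frac{3}{16}$,
    whose cube exceeds $1/200$, and $x/(N+1)$ is at least $1/2$. *)
Lemma trial_ge x : 1 <= N -> N + 1 / 4 <= x <= N + 3 / 4 -> 1 / 400 <= (trial x).1.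
Proof.
move=> N1 /andP[Nx xN].
have t0 : 3 / 16 <= tent x.
  have : 0 <= (x - N - 1 / 4) * (N + 3 / 4 - x) by rewrite mulr_ge0//; lra.
  by rewrite /tent; lra.
have [p0 _ _] := @pcube_ge0 _ (tent x) ltac:(lra).
have p3 : 1 / 200 <= pcube (tent x).
  rewrite p0; apply: (@le_trans _ _ ((3 / 16) ^+ 3)); first by lra.
  by apply: lerXn2r; rewrite ?nnegrE//; lra.
have xk : 1 / 2 <= x * (N + 1)^-1.
  by rewrite ler_pdivlMr; lra.
by rewrite /= /cutoff mulrA; nra.
Qed.

End singular_sequence.

(** * The potential: measurability, local integrability and growth *)

Section potential.
Variable R : realType.
Implicit Type x : R.

Definition potential x : R := x * amp x.

Lemma measurable_amp (D : set R) : measurable_fun D (@amp R).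
Proof.
apply: measurable_funTS.
have mc : measurable_fun setT (@wcos R) := is_derive_measurable (@is_derive_wcos R).
apply: measurableT_comp => //; apply: measurable_funM.
  by apply: measurable_fun_ifT => //; exact: measurable_fun_ler.
apply: measurable_funB; last by apply: measurable_funM => //; exact: measurable_funX.
apply: measurable_funD => //; apply: measurable_funM => //.
exact: measurableT_comp.
Qed.

Lemma measurable_potential (D : set R) : measurable_fun D potential.
Proof. by apply: measurable_funM => //; exact: measurable_amp. Qed.

Lemma L1loc_potential : L1loc potential.
Proof.
move=> b b0; apply: measurable_bounded_integrable => //.
- by rewrite /= lebesgue_measure_itv/= lte_fin b0 -EFinD ltry.
- exact: measurable_potential.
- exists (b * 3); split; rewrite ?num_real// => M bM x /=.
  rewrite in_itv/= => /andP[x0 xb]; apply: le_trans (ltW bM).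
  by rewrite normrM ger0_norm//; apply: ler_pM => //; exact: norm_amp_le.
Qed.

(** $1 + 2|c| - 2c^2 = 1 + 2|c|(1 - |c|)$ with $|c| \le 1$. *)
Lemma amp_ge1 x : 1 <= `|amp x|.
Proof.
rewrite norm_amp -(real_normK (num_real (wcos x))).
by have := norm_wcos_le1 x; have := normr_ge0 (wcos x); nra.
Qed.

Lemma cvg_norm_potential : (fun x => `|potential x|) @ +oo --> +oo.
Proof.
apply/cvgryPge => A; near=> x.
have x0 : 0 <= x by near: x; apply: nbhs_pinfty_ge; rewrite num_real.
rewrite normrM ger0_norm//; apply: (@le_trans _ _ x).
  by near: x; apply: nbhs_pinfty_ge; rewrite num_real.
by apply: ler_peMr => //; exact: amp_ge1.
Unshelve. all: by end_near. Qed.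

(* [cadd] and [cscale] alone would denote the homonyms from [charge]. *)
Lemma csubK (f h : cfun R) : Defs.cadd (csub f h) h = f.
Proof.
apply/funext => x; rewrite /Defs.cadd /csub/= !subrK.
by case: (f x).
Qed.

(** * Membership of the trial functions in the domain of $L_0$, norm bounds and separation *)

Variable N : R.

Lemma measurable_trial (D : set R) :
  measurable_fun D (fun x => (trial N x).1) /\
  measurable_fun D (fun x => (trial N x).2).
Proof.
split; first exact: is_derive_measurable (is_derive_trial_re N).
exact: is_derive_measurable (is_derive_trial_im N).
Qed.

Lemma measurable_trial_image (D : set R) :
  measurable_fun D (fun x => (trial_image N x).1) /\
  measurable_fun D (fun x => (trial_image N x).2).
Proof.
have mb := is_derive_measurable (D := D) (is_derive_cutoff N).
have mb1 := is_derive_measurable (D := D) (is_derive_cutoff1 N).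
have mt := is_derive_measurable (D := D) (is_derive_tent N).
have mw := is_derive_measurable (D := D) (@is_derive_wave R).
have mc := is_derive_measurable (D := D) (@is_derive_wcos R).
have ms := is_derive_measurable (D := D) (@is_derive_wsin R).
have ma := @measurable_amp D.
have mn (f : R -> R) : measurable_fun D f -> measurable_fun D (fun x => `|f x|).
  by move=> mf; exact: measurableT_comp.
have mdt : measurable_fun D (dtent N).
  by apply: measurable_funB => //; exact: measurable_funM.
have mb2 : measurable_fun D (cutoff2 N).
  apply: measurable_funM => //; apply: measurable_funB; apply: measurable_funM => //.
  - apply: measurable_funM => //.
    by apply: measurable_funD => //; exact: mn.
  - exact: measurable_funX.
  - exact: (measurableT_comp (is_derive_measurable (@is_derive_pcube1 R))).
split.
  apply: measurable_funB; last first.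
    by apply: measurable_funM; exact: measurable_funM.
  apply: measurableT_comp => //.
  by apply: measurable_funD; exact: measurable_funM.
apply: measurable_funB; last exact: measurable_funM.
apply: measurable_funM.
  apply: measurable_funM => //; apply: measurable_funB => //; exact: mn.
apply: measurable_funD => //; apply: measurable_funM => //.
Qed.

(** At the zeros of [wcos] nothing is established about the value of [derive1] in [Lexpr]; these
    points are countable, so they affect neither measurability nor norms. *)
Lemma Lexpr_trial_off : exists2 Z : set R, countable Z &
  forall x, Rp x -> ~ Z x ->
    Lexpr potential (trial N) (trial1 N) x = trial_image N x.
Proof.
exists [set x | 0 <= x /\ wcos x = 0]; first exact: countable_wcos_eq0.
move=> x; rewrite /Rp/= in_itv/= andbT => x0 Zx; apply: Lexpr_trial.
by apply/eqP => cx; exact: Zx.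
Qed.

Lemma measurable_Lexpr_trial :
  measurable_fun (@Rp R) (fun x => (Lexpr potential (trial N) (trial1 N) x).1) /\
  measurable_fun (@Rp R) (fun x => (Lexpr potential (trial N) (trial1 N) x).2).
Proof.
have [Z cZ LZ] := Lexpr_trial_off.
have [m1 m2] := measurable_trial_image (@Rp R).
by split; [apply: (eq_measurable_fun_countable cZ _ m1)
          |apply: (eq_measurable_fun_countable cZ _ m2)] => x Rx Zx; rewrite LZ.
Qed.

Lemma L2_trial : 1 <= N -> L2 (trial N).
Proof.
move=> N1; have [m1 m2] := measurable_trial (@Rp R); split => //.
apply: (@le_lt_trans _ _ 10%:E); last exact: ltry.
apply: (@sqnorm_le_unit _ _ N) => //; first by lra.
by apply: (@ae_countable R set0) => [|x _ _]; [exact: countable0|exact: trial_le].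
Qed.

(** From $|u - ly|^2 \le 2|u|^2 + 2|l|^2|y|^2$ with the pointwise bounds 700 and 10. The bound does
    not depend on [N]. *)
Lemma sqnorm_Lexpr_trial (l : R * R) : 1 <= N ->
  (sqnorm (csub (Lexpr potential (trial N) (trial1 N)) (Defs.cscale l (trial N))) <=
   (1400 + 20 * (l.1 ^+ 2 + l.2 ^+ 2))%:E)%E.
Proof.
move=> N1; have [Z cZ LZ] := Lexpr_trial_off.
have [m1 m2] := measurable_trial (@Rp R).
have [n1 n2] := measurable_Lexpr_trial.
have l0 : 0 <= l.1 ^+ 2 + l.2 ^+ 2 by rewrite addr_ge0 ?sqr_ge0.
apply: (@sqnorm_le_unit _ _ N); [lra|lra| | |].
- by apply: measurable_funB => //; apply: measurable_funB; exact: measurable_funM.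
- by apply: measurable_funB => //; apply: measurable_funD; exact: measurable_funM.
apply: (ae_countable cZ) => x Zx Rx; rewrite /csub LZ// /Defs.cscale.
have := trial_le x N1; have := trial_image_le x N1.
move: (trial N x) (trial_image N x) (\1_ _ x) => [a b] [u v] k /= uk ak.
have sq (s t : R) : (s - t) ^+ 2 <= 2 * s ^+ 2 + 2 * t ^+ 2.
  by have := sqr_ge0 (s + t); lra.
have -> : (1400 + 20 * (l.1 ^+ 2 + l.2 ^+ 2)) * k =
    2 * (700 * k) + 2 * ((l.1 ^+ 2 + l.2 ^+ 2) * (10 * k)) by ring.
have := ler_wpM2l l0 ak.
have -> : (l.1 ^+ 2 + l.2 ^+ 2) * (a ^+ 2 + b ^+ 2) =
    (l.1 * a - l.2 * b) ^+ 2 + (l.1 * b + l.2 * a) ^+ 2 by ring.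
have := sq u (l.1 * a - l.2 * b); have := sq v (l.1 * b + l.2 * a).
by lra.
Qed.

Lemma csub_cscale0 (f g : cfun R) : csub f (Defs.cscale (0, 0) g) = f.
Proof.
by apply/funext => x; rewrite /csub /Defs.cscale/=; case: (f x) => a b /=; congr (_, _); ring.
Qed.

Lemma L0graph_trial : 1 <= N ->
  L0graph potential (trial N, Lexpr potential (trial N) (trial1 N)).
Proof.
move=> N1; exists (trial1 N) => /=.
have b0 x : x <= N \/ N + 1 <= x -> cutoff N x = 0 /\ cutoff1 N x = 0.
  by move=> /cutoff_out[].
split; first exact: L2_trial.
split; first exact: cACloc_trial.
split; first exact: cACloc_trial1.
split; first by move=> x _; split; [exact: is_derive_trial_re|exact: is_derive_trial_im].
split.
  have [n1 n2] := measurable_Lexpr_trial; split=> //.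
  (* Square integrability of the image is the case $l = 0$ of the previous bound. *)
  rewrite -[X in sqnorm X](csub_cscale0 _ (trial N)).
  by apply: le_lt_trans (sqnorm_Lexpr_trial _ N1) _; exact: ltry.
(* As $N \ge 1$, the origin lies to the left of the support. *)
have [z0 z1] := b0 0 ltac:(left; lra).
split; first by rewrite /trial z0 !mulr0.
split; first by rewrite /trial1 z0 z1 !(mulr0, addr0).
split=> //; exists (N + 1); split; first by lra.
by move=> x xN; rewrite /trial (b0 x (or_intror xN)).1 !mulr0.
Qed.

(** No [f] is close to two trial functions with disjoint supports. On the middle half of $[N, N+1]$,
    of length $1/2$, the second one vanishes while the first is at least $1/400$. Comparing both
    with [f] pointwise avoids a triangle inequality for norms. *)
Lemma trial_separated (N' : R) (f : cfun R) : 1 <= N -> N + 1 <= N' -> L2 f ->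
  (((1 / 400) ^+ 2 / 2)%:E <= 2%:E * sqnorm (csub (trial N) f) +
                      2%:E * sqnorm (csub (trial N') f))%E.
Proof.
move=> N1 NN' [mf1 mf2 _].
pose h (M : R) x := (((csub (trial M) f x).1 ^+ 2 + (csub (trial M) f x).2 ^+ 2)%:E)%E.
have mh M : measurable_fun (@Rp R) (h M).
  apply: measurable_sqnorm; apply: measurable_funB => //;
    [exact: is_derive_measurable (is_derive_trial_re M)
    |exact: is_derive_measurable (is_derive_trial_im M)].
have h0 M x : (0 <= h M x)%E by rewrite lee_fin addr_ge0 ?sqr_ge0.
have m2h M : measurable_fun (@Rp R) (fun x => 2%:E * h M x)%E by exact: measurable_funeM.
have h20 M x : (0 <= 2%:E * h M x)%E by rewrite mule_ge0// lee_fin.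
have mR := @measurable_Rp R.
have hE M : (2%:E * sqnorm (csub (trial M) f) =
    \int[@lebesgue_measure R]_(x in @Rp R) (2%:E * h M x))%E.
  by rewrite ge0_integralZl_EFin//; exact: mh.
rewrite !hE -ge0_integralD//; [|exact: m2h|exact: m2h].
pose J : set R := `[N + 1 / 4, N + 3 / 4]%classic.
have mJ : measurable J by exact: measurable_itv.
have JR : J `<=` @Rp R.
  by move=> x; rewrite /J /Rp/= !in_itv/= andbT => /andP[x1 _]; lra.
apply: (@le_trans _ _ (\int[@lebesgue_measure R]_(x in J)
    (2%:E * h N x + 2%:E * h N' x))%E); last first.
  apply: ge0_subset_integral => //; first by apply: emeasurable_funD; exact: m2h.
  by move=> x _; rewrite adde_ge0.
apply: (@le_trans _ _ (\int[@lebesgue_measure R]_(x in J) ((1 / 400) ^+ 2)%:E)%E).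
  rewrite integral_cst//= /J lebesgue_measure_itv/= lte_fin ifT; last by lra.
  by rewrite -EFinD -EFinM lee_fin; lra.
apply: ge0_le_integral => //.
- by apply: (measurable_funS mR) => //; apply: emeasurable_funD; exact: m2h.
move=> x; rewrite /J/= in_itv/= => xJ; have := trial_ge N1 xJ.
have [|z _ _] := @cutoff_out _ N' x; first by case/andP: xJ => _ ?; left; lra.
rewrite /h -!EFinM -EFinD lee_fin /csub /= z !mulr0 !sub0r !sqrrN.
move: (x * cutoff N x) (wave x * cutoff N x) (f x) => a b [c d] /= a1.
(* The identity used is $2(a - c)^2 + 2c^2 = a^2 + (a - 2c)^2$. *)
have := sqr_ge0 (a - 2 * c); have := sqr_ge0 (b - d); have := sqr_ge0 d.
by nra.
Qed.

End potential.

(* q = i * qi with qi : R -> R real-valued *)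
Theorem theorem3 (R : realType) :
  exists qi : R -> R,
    [/\ L1loc qi,
        (fun x => `|qi x|) @ +oo --> +oo
      & ~ exists G : set (cfun R * cfun R),
            [/\ is_operator G, L0graph qi `<=` G & has_compact_resolvent G]].
Proof.
exists (@potential R); split; [exact: L1loc_potential|exact: cvg_norm_potential|].
move=> [G [_ L0G [l [_ _ _ comp]]]].
(* The shift by one gives $N \ge 1$, as the bounds require. *)
pose N n : R := n.+1%:R.
have N1 n : 1 <= N n by rewrite ler1n.
(* This is $(L_0 - l)y_n$, which the resolvent at [l] sends back to $y_n$. *)
pose g n := csub (Lexpr (@potential R) (trial (N n)) (trial1 (N n)))
  (Defs.cscale l (trial (N n))).
have gM n := sqnorm_Lexpr_trial l (N1 n).
have [n|n||phi [phiS [f [L2f cvf]]]] :=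
    comp (fun n => trial (N n)) g (1400 + 20 * (l.1 ^+ 2 + l.2 ^+ 2)).
- have [m1 m2] := measurable_trial (N n) (@Rp R).
  have [n1 n2] := measurable_Lexpr_trial (N n).
  split; last by apply: le_lt_trans (gM n) _; exact: ltry.
  + by apply: measurable_funB => //; apply: measurable_funB; exact: measurable_funM.
  + by apply: measurable_funB => //; apply: measurable_funD; exact: measurable_funM.
- apply: L0G; have -> : Defs.cadd (g n) (Defs.cscale l (trial (N n))) =
      Lexpr (@potential R) (trial (N n)) (trial1 (N n)).
    exact: csubK.
  exact: L0graph_trial.
- exact: gM.
(* Two distances below this threshold, each doubled, sum to less than $(1/400)^2/4$, under the
   separation constant $(1/400)^2/2$. *)
have /cvf [n0 _ n0P] : nbhs (0%E : \bar R) [set e | (e < ((1 / 400) ^+ 2 / 16)%:E)%E].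
  by apply: (@lt_nbhsl R 0 ((1 / 400) ^+ 2 / 16)); lra.
have lt1 := n0P _ (leqnn n0); have lt2 := n0P _ (leqnSn n0).
(* Since [phi] increases strictly, consecutive terms of the subsequence have supports with disjoint
   interiors. *)
have NN : N (phi n0) + 1 <= N (phi n0.+1).
  by rewrite /N natr1 ler_nat ltnS; exact: phiS.
have := trial_separated (N1 _) NN L2f.
rewrite leNgt => /negP; apply.
apply: (@le_lt_trans _ _ (2%:E * ((1 / 400) ^+ 2 / 16)%:E + 2%:E * ((1 / 400) ^+ 2 / 16)%:E)%E).
  by apply: leeD; apply: lee_wpmul2l; rewrite ?lee_fin//; exact: ltW.
by rewrite -!EFinM -EFinD lte_fin; lra.
Qed.
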